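(* Let $\phi:U\to W$ be a representation over a field $\Bbbk$ of the uniform matroid $U_{r,n}$ on $S=\{1,\dots,n\}$, and let $V=\operatorname{Im}\phi$. Then $$\{\phi(e_B)\mid B\subseteq S,\ |B|=n-r-1,\ 1,2\notin B\}$$ is a basis of $S_S(\phi)=\mathrm{Sym}^{\,n-r-1}V$, the $(n-r-1)$-st symmetric power of $V$, where for $B=\{b_1,\dots,b_{n-r-1}\}$ we put $\phi(e_B)=\phi(e_{b_1})\phi(e_{b_2})\cdots\phi(e_{b_{n-r-1}})$ (product in the symmetric algebra of $V$).
   Context: $U$ is a $\Bbbk$-vector space with basis $\{e_1,\dots,e_n\}$ and $\phi:U\to W$ is linear. That $\phi$ represents $U_{r,n}$ means: $\phi$ has rank $r$ and every $r$-element subset of $\{\phi(e_1),\dots,\phi(e_n)\}$ (indexed by $r$-element subsets of $S$) is a basis of $V=\operatorname{Im}\phi$. The empty product is $1$, and symmetric powers of negative degree are $0$. Multiplicity space $S_S(\phi)$: for $I\subseteq S$ let $V_I=\mathrm{span}\{\phi(e_i)\mid i\in I\}$ and $l(I)=|I|-\dim V_I-1$. A T-flat is a non-empty union of circuits. If $S$ is a T-flat with $l=l(S)$, then $S_S(\phi)\subseteq\mathrm{Sym}^l(V)$ is the span of all products $w_1\cdots w_l$ with $w_i\in V_{J_i\setminus J_{i-1}}\cap V_{J_{i-1}}$, over all chains $J_0\subset\cdots\subset J_l=S$ of T-flats with $l(J_i)=i$ (for $l=0$ it is $\Bbbk$, spanned by the empty product); if $S$ is not a T-flat, $S_S(\phi)=0$.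 *)

(* Defs.v *)
From HB Require Import structures.
From mathcomp Require Import all_boot all_order all_algebra.
From mathcomp Require Import boolp classical_sets.
From mathcomp Require Import mpoly.

Set Implicit Arguments.
Unset Strict Implicit.
Unset Printing Implicit Defensive.

Import GRing.Theory.
Local Open Scope classical_set_scope.
Local Open Scope ring_scope.

Section LinearAlgebra.
Context {K : fieldType} {M : lmodType K}.

Definition lspan (X : set M) : set M :=
  [set v | exists (m : nat) (c : 'I_m -> K) (x : 'I_m -> M),
     (forall i, X (x i)) /\ v = \sum_(i < m) c i *: x i].

Definition free_on (I : finType) (D : {set I}) (f : I -> M) : Prop :=
  forall c : I -> K, \sum_(i in D) c i *: f i = 0 ->
    forall i, i \in D -> c i = 0.

(* Bases are indexed families, so the f i (i \in D) are distinct. *)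
Definition basis_on (I : finType) (D : {set I}) (f : I -> M) (X : set M) :
    Prop :=
  free_on D f /\ lspan (f @` [set` D]) = X.

(* The default value 0 is taken only if X is not a finite-dimensional
   subspace. *)
Definition dimension (X : set M) : nat :=
  xget 0%N [set d | exists b : 'I_d -> M, basis_on [set: 'I_d]%SET b X].

End LinearAlgebra.

(* W need not be finite-dimensional, so that Im phi is not available as a
   {vspace W}; it is built as a subtype of W. *)
Section Image.
Context {K : fieldType} {U W : lmodType K} (phi : {linear U -> W}).

Definition im_pred : {pred W} := fun w => `[< range phi w >].

Lemma im_pred_closed : submod_closed im_pred.
Proof.
split=> [|a v w /asboolP[u _ <-] /asboolP[u' _ <-]]; apply/asboolP.
  by exists 0; rewrite ?linear0.
by exists (a *: u + u') => //; rewrite linearP.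
Qed.

HB.instance Definition _ :=
  GRing.isSubmodClosed.Build K W im_pred im_pred_closed.

Record im_space := ImSpace { im_val : W; _ : im_val \in im_pred }.

HB.instance Definition _ := [isSub for im_val].
HB.instance Definition _ := [Choice of im_space by <:].
HB.instance Definition _ := [SubChoice_isSubLmodule of im_space by <:].

Lemma im_predP (u : U) : phi u \in im_pred.
Proof. by apply/asboolP; exists u. Qed.

Definition im_of (u : U) : im_space := ImSpace (im_predP u).

End Image.

Section SymmetricAlgebra.
Context {K : fieldType} {V : lmodType K}.

(* (A, iota) is a symmetric algebra of V, by its universal property. *)
Definition is_symmetric_algebra (A : comAlgType K) (iota : {linear V -> A}) :
    Prop :=
  forall (B : comAlgType K) (f : {linear V -> B}),
    (exists g : {lrmorphism A -> B}, forall v, g (iota v) = f v) /\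
    (forall g h : {lrmorphism A -> B},
       (forall v, g (iota v) = f v) -> (forall v, h (iota v) = f v) ->
       forall a, g a = h a).

Definition sym_power (A : comAlgType K) (iota : {linear V -> A}) (d : int) :
    set A :=
  match d with
  | Posz d => lspan [set a | exists v : 'I_d -> V, a = \prod_(i < d) iota (v i)]
  | Negz _ => [set 0]
  end.

End SymmetricAlgebra.

(* Polynomial rings are symmetric algebras of finite-dimensional spaces, so the
   hypothesis is_symmetric_algebra is satisfiable. *)
Lemma mpoly_symmetric_algebra (K : fieldType) (V : lmodType K) (m : nat)
    (b : 'I_m -> V) :
  basis_on [set: 'I_m]%SET b [set: V] ->
  exists iota : {linear V -> {mpoly K[m]}},
    (forall i, iota (b i) = 'X_i) /\ is_symmetric_algebra iota.
Proof.
case=> fb sb.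
have coordE v : exists c : 'I_m -> K, v = \sum_i c i *: b i.
  have: [set: V] v by [].
  rewrite -sb => -[k [c [x [xP ->]]]].
  have /choice[s sE] : forall i, exists j, x i = b j.
    by move=> i; have [j _ <-] := xP i; exists j.
  exists (fun j => \sum_(i < k | s i == j) c i).
  rewrite (partition_big s xpredT) //=; apply: eq_bigr => j _.
  rewrite scaler_suml; apply: eq_bigr => i /eqP <-; by rewrite sE.
have /choice[c cE] := coordE.
have cU v d : v = \sum_i d i *: b i -> c v =1 d.
  move=> vE i; apply/eqP; rewrite -subr_eq0; apply/eqP.
  apply: (fb (fun i => c v i - d i)); last by rewrite inE.
  rewrite (eq_bigl xpredT) => [|j]; last by rewrite inE.
  under eq_bigr do rewrite scalerBl.
  by rewrite sumrB -cE -vE subrr.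
pose f v : {mpoly K[m]} := \sum_i c v i *: 'X_i.
have fL : linear f.
  move=> a u v; rewrite /f scaler_sumr -big_split; apply: eq_bigr => i _ /=.
  rewrite scalerA -scalerDl; congr (_ *: _).
  apply: (cU _ (fun i => a * c u i + c v i)).
  rewrite {1}(cE u) {1}(cE v) scaler_sumr -big_split.
  by apply: eq_bigr => j _ /=; rewrite scalerDl scalerA.
pose iota : {linear V -> {mpoly K[m]}} :=
  HB.pack f (GRing.isLinear.Build _ _ _ _ f fL).
have iotab i : iota (b i) = 'X_i.
  rewrite /= /f (bigD1 i) //= big1 => [|j ji].
    by rewrite (cU _ (fun j => (j == i)%:R)) ?eqxx ?scale1r ?addr0 //
      (bigD1 i) //= eqxx scale1r big1 ?addr0 // => j /negPf->; rewrite scale0r.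
  by rewrite (cU _ (fun j => (j == i)%:R)) ?(negPf ji) ?scale0r //
      (bigD1 i) //= eqxx scale1r big1 ?addr0 // => k /negPf->; rewrite scale0r.
exists iota; split=> // B g; split.
  pose h (p : {mpoly K[m]}) : B := mmap (in_alg B) (g \o b) p.
  have hZ : scalable h.
    by move=> a p; rewrite /h mmapZ /= mulr_algl.
  have hD : additive h by exact: mmap_is_additive.
  have hM : multiplicative h by exact: mmap_is_multiplicative.
  pose H : {lrmorphism {mpoly K[m]} -> B} :=
    HB.pack h (GRing.isAdditive.Build _ _ h hD)
      (GRing.isMultiplicative.Build _ _ h hM)
      (GRing.isScalable.Build _ _ _ _ h hZ).
  exists H => v; rewrite [in RHS](cE v) [iota v]/(f v) /f !linear_sum.
  apply: eq_bigr => i _; rewrite !linearZ /=; congr (_ *: _).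
  by rewrite /h mmapX mmap1U.
move=> h1 h2 h1E h2E p.
have hX i : h1 'X_i = h2 'X_i by rewrite -iotab h1E h2E.
rewrite (mpolyE p) !linear_sum; apply: eq_bigr => k _; rewrite !linearZ.
congr (_ *: _); rewrite mpolyXE_id !rmorph_prod; apply: eq_bigr => i _.
by rewrite !rmorphXn /=; congr (_ ^+ _); exact: hX.
Qed.

Section Matroid.
Context {K : fieldType} {W : lmodType K} {n : nat} (x : 'I_n -> W).

Definition subspan (I : {set 'I_n}) : set W := lspan (x @` [set` I]).

Definition level (I : {set 'I_n}) : int :=
  #|I|%:Z - (dimension (subspan I))%:Z - 1.

Definition circuit (C : {set 'I_n}) : Prop :=
  ~ free_on C x /\ forall D : {set 'I_n}, D \proper C -> free_on D x.

Definition tflat (J : {set 'I_n}) : Prop :=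
  J <> finset.set0 /\
  exists P : {set {set 'I_n}}, (forall C, C \in P -> circuit C) /\ J = finset.cover P.

End Matroid.

Section Representation.
Context {K : fieldType} {U W : lmodType K} {n : nat}.
Context (e : 'I_n -> U) (phi : {linear U -> W}).

Definition represents_uniform (r : nat) : Prop :=
  dimension (range phi) = r /\
  forall I : {set 'I_n}, #|I| = r -> basis_on I (phi \o e) (range phi).

Context (A : comAlgType K) (iota : {linear im_space phi -> A}).

(* Only J 0, ..., J l matter; the inclusions are strict because the levels of
   J i and J i.+1 differ. *)
Definition mult_generator (l : nat) : set A :=
  [set a | exists (J : nat -> {set 'I_n}) (w : 'I_l -> im_space phi),
    [/\ forall i, (i <= l)%N -> tflat (phi \o e) (J i) /\
                                level (phi \o e) (J i) = i%:Z,
        forall i, (i < l)%N -> J i \subset J i.+1,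
        J l = [set: 'I_n]%SET,
        forall i : 'I_l,
          (subspan (phi \o e) (J i.+1 :\: J i) `&` subspan (phi \o e) (J i))
            (im_val (w i))
      & a = \prod_(i < l) iota (w i)]].

(* A T-flat has level >= 0, so the second branch is never taken for one. *)
Definition mult_space : set A :=
  [set a | if `[< tflat (phi \o e) [set: 'I_n]%SET >] then
             match level (phi \o e) [set: 'I_n]%SET with
             | Posz l => lspan (mult_generator l) a
             | Negz _ => a = 0
             end
           else a = 0].

Definition phi_prod (B : {set 'I_n}) : A := \prod_(b in B) iota (im_of phi (e b)).

End Representation.

(* Main.v *)
Require Import Defs.
From HB Require Import structures.
From mathcomp Require Import all_boot all_order all_algebra.
From mathcomp Require Import boolp classical_sets.
From mathcomp Require Import zify.

(** Write d = n - r - 1 and x_i = phi(e_i); any r of the x_i form a basis of V.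
    If d < 0, the multiplicity space, the symmetric power and the family are
    all trivial, so let d >= 0 and T = S \ {1, 2}.

    The x_B with |B| = d and B inside T span Sym^d V, by induction on the
    degree ([squarefree_products_span]): for |B| < d the set T \ B still has at
    least r elements, so any further factor is a combination of x_j with j
    outside B, and multiplying x_B by such an x_j gives another squarefree
    product.

    They are independent by evaluation at points of the dual of V
    ([squarefree_products_free]).  For d > 0 and |B| = d the set T \ B has
    r - 1 elements, hence some linear form on V kills x_i exactly when i lies in
    T \ B ([general_position_form]).  It extends to an algebra morphism from the
    symmetric algebra to the field, which kills every x_E except x_B.

    Finally x_B lies in the multiplicity space as soon as |B| = d
    ([phi_prod_generator]): the sets with more than r elements are T-flats, all
    spanning V, so adding the elements of B one at a time to the circuit S \ B
    gives a chain of T-flats with levels 0, ..., d, and x_b is an admissible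
    vector for the step that adds b.  Since the multiplicity space is contained
    in Sym^d V by construction, the two coincide and the x_B form a basis. *)

Set Implicit Arguments.
Unset Strict Implicit.
Unset Printing Implicit Defensive.

Import GRing.Theory.
Local Open Scope classical_set_scope.
Local Open Scope ring_scope.

(** * Linear spans and free families *)

Section LinearSpan.
Context {K : fieldType} {M : lmodType K}.
Implicit Types (X Y : set M).

Lemma mem_lspan X v : X v -> lspan X v.
Proof.
move=> Xv; exists 1%N, (fun=> 1), (fun=> v); split=> //.
by rewrite big_ord1 scale1r.
Qed.

Lemma lspan0 X : lspan X 0.
Proof.
by exists 0%N, (fun=> 0), (fun=> 0); split; [case | rewrite big_ord0].
Qed.

Lemma lspanD X u v : lspan X u -> lspan X v -> lspan X (u + v).
Proof.
move=> [m [c [x [xX ->]]]] [p [d [y [yX ->]]]].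
exists (m + p)%N, (fun i => match split i with inl j => c j | inr j => d j end),
  (fun i => match split i with inl j => x j | inr j => y j end).
split=> [i|]; first by case: split.
rewrite big_split_ord /=; congr (_ + _); apply: eq_bigr => i _.
  by rewrite (unsplitK (inl i)).
by rewrite (unsplitK (inr i)).
Qed.

Lemma lspanZ X a v : lspan X v -> lspan X (a *: v).
Proof.
move=> [m [c [x [xX ->]]]]; exists m, (fun i => a * c i), x; split=> //.
by rewrite scaler_sumr; apply: eq_bigr => i _; rewrite scalerA.
Qed.

Lemma lspan_sum X (I : Type) (s : seq I) (P : pred I) (F : I -> M) :
  (forall i, P i -> lspan X (F i)) -> lspan X (\sum_(i <- s | P i) F i).
Proof. by move=> XF; apply: big_ind => //; [exact: lspan0 | exact: lspanD]. Qed.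

Lemma lspan_least X Y : X `<=` lspan Y -> lspan X `<=` lspan Y.
Proof.
move=> XY v [m [c [x [xX ->]]]]; apply: lspan_sum => i _.
exact/lspanZ/XY.
Qed.

Lemma lspan_set0 : lspan (@set0 M) = [set 0].
Proof.
apply/seteqP; split=> [v [m [c [x [xX ->]]]] /=|_ ->]; last exact: lspan0.
by apply: big1 => i; case: (xX i).
Qed.

(** Repeated vectors in a combination are merged, so one coefficient for each
    index is enough. *)
Lemma lspan_imageP (I : finType) (D : {set I}) (f : I -> M) v :
  lspan (f @` [set` D]) v <-> exists c : I -> K, v = \sum_(i in D) c i *: f i.
Proof.
split=> [[m [c [x [xD ->]]]]|[c ->]]; last first.
  by apply: lspan_sum => i iD; apply/lspanZ/mem_lspan; exists i.
have /choice[s sE] i : exists j, j \in D /\ f j = x i.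
  by have [j jD <-] := xD i; exists j.
exists (fun j => \sum_(i < m | s i == j) c i).
rewrite (partition_big s (mem D)) /= => [|i _]; last by have [] := sE i.
apply: eq_bigr => j _; rewrite scaler_suml; apply: eq_bigr => i /eqP <-.
by have [_ ->] := sE i.
Qed.

Lemma free_on_sub (I : finType) (D E : {set I}) (f : I -> M) :
  D \subset E -> free_on E f -> free_on D f.
Proof.
move=> DE fE c c0 i iD.
have := fE (fun j => if j \in D then c j else 0) _ i (fintype.subsetP DE i iD).
rewrite iD; apply; rewrite -[RHS]c0 (big_setID D) /= addrC big1 => [|j].
  rewrite add0r (finset.setIidPr DE); apply: eq_bigr => j ->; by [].
by rewrite inE => /andP[/negPf-> _]; rewrite scale0r.
Qed.

Lemma not_free_on (I : finType) (D : {set I}) (f : I -> M) j :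
  j \in D -> lspan (f @` [set` D :\ j]) (f j) -> ~ free_on D f.
Proof.
move=> jD /lspan_imageP[c fj] /(_ (fun i => if i == j then -1 else c i)) fD.
have /eqP: (-1 : K) = 0; last by rewrite oppr_eq0 oner_eq0.
have := fD _ j jD; rewrite eqxx; apply.
rewrite (big_setD1 j) //= eqxx scaleN1r {1}fj addrC -sumrB big1 // => i.
by rewrite !inE => /andP[/negPf-> _]; rewrite subrr.
Qed.

(** The j-th coordinate, which is linear because coordinates in a basis are
    unique.  The codomain is K^o so that the form can later be extended to a
    morphism of K-algebras. *)
Lemma coordinate_form (I : finType) (D : {set I}) (f : I -> M) j :
  j \in D -> basis_on D f [set: M] ->
  exists g : {linear M -> K^o}, g (f j) = 1 /\
    forall i, i \in D -> i != j -> g (f i) = 0.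
Proof.
move=> jD [fD sD].
have /choice[c cE] (v : M) : exists c : I -> K, v = \sum_(i in D) c i *: f i.
  by apply/lspan_imageP; rewrite sD.
have cU v d i : v = \sum_(i in D) d i *: f i -> i \in D -> c v i = d i.
  move=> vE iD; apply/eqP; rewrite -subr_eq0; apply/eqP.
  apply: (fD (fun k => c v k - d k)) => //.
  under eq_bigr do rewrite scalerBl.
  by rewrite sumrB -cE -vE subrr.
pose g (v : M) : K^o := c v j.
have gL : linear g.
  move=> a u v; apply: (cU _ (fun i => a * c u i + c v i)) => //.
  rewrite {1}(cE u) {1}(cE v) scaler_sumr -big_split.
  by apply: eq_bigr => i _ /=; rewrite scalerDl scalerA.
have gf i : i \in D -> g (f i) = (j == i)%:R.
  move=> iD; apply: (cU _ (fun k => (k == i)%:R)) => //.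
  rewrite (big_setD1 i) //= eqxx scale1r big1 ?addr0 // => k.
  by rewrite !inE => /andP[/negPf-> _]; rewrite scale0r.
pose G : {linear M -> K^o} := HB.pack g (GRing.isLinear.Build _ _ _ _ g gL).
exists G; split=> [|i iD ij] /=.
  by rewrite gf // eqxx.
by rewrite gf // eq_sym (negPf ij).
Qed.

End LinearSpan.

(** * Cardinals of finite sets *)

Lemma exists_subset_card (I : finType) (D : {set I}) k :
  (k <= #|D|)%N -> exists2 E : {set I}, E \subset D & #|E| = k.
Proof.
rewrite cardE => kD; exists [set:: take k (enum D)]%SET.
  by apply/fintype.subsetP => i; rewrite inE => /mem_take; rewrite mem_enum.
by rewrite cardsE (card_uniqP _) ?take_uniq ?enum_uniq // size_takel.
Qed.

Lemma card_ord_gt1 n : #|[set b : 'I_n | (1 < b)%N]%SET| = n.-2.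
Proof.
rewrite -sum1dep_card; case: n => [|[|n]]; first by rewrite big_ord0.
  by rewrite big_pred0 // => b; rewrite ord1.
rewrite big_mkcond !big_ord_recl /= !add0n -[RHS]card_ord -sum1_card.
by apply: eq_bigr.
Qed.

(** * Squarefree products of vectors in general position *)

Section GeneralPosition.
Context {K : fieldType} {V : lmodType K} {I : finType} {x : I -> V} {r : nat}.
Hypothesis gp : forall E : {set I}, #|E| = r -> basis_on E x [set: V].

(** Adding any index outside C to C gives a basis.  The coordinate along x j0
    vanishes on the x i with i in C; were it also to vanish on x i for another i
    outside C, it would vanish on a basis of V, whereas it is 1 at x j0. *)
Lemma general_position_form (C : {set I}) j0 :
  j0 \notin C -> #|C|.+1 = r ->
  exists f : {linear V -> K^o}, forall i, (f (x i) == 0) = (i \in C).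
Proof.
move=> j0C Cr.
have gpC j : j \notin C -> basis_on (j |: C)%SET x [set: V].
  by move=> jC; apply: gp; rewrite cardsU1 jC.
have [f [fj0 f0]] := coordinate_form (setU11 j0 C) (gpC _ j0C).
have fC i : i \in C -> f (x i) = 0.
  move=> iC; apply: f0; first exact: setU1r.
  by apply: contraNneq j0C => <-.
exists f => i; apply/idP/idP => [/eqP fi|/fC->//].
apply: contraT => iC; have [_ si] := gpC i iC.
have: lspan (x @` [set` (i |: C)%SET]) (x j0) by rewrite si.
case/lspan_imageP => c xj0; have := oner_neq0 K.
rewrite -fj0 xj0 linear_sum big1 ?eqxx // => k.
by rewrite linearZ /= !inE => /predU1P[->|/fC->]; rewrite ?fi scaler0.
Qed.

Context {A : comAlgType K} {iota : {linear V -> A}}.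
Local Notation xprod B := (\prod_(b in B) iota (x b)).

(** The bound on T leaves r indices of T outside any B with |B| < d, so the
    last factor can be expanded on vectors whose indices are not in B. *)
Lemma squarefree_products_span (T : {set I}) d (v : 'I_d -> V) :
  (d + r <= #|T|.+1)%N ->
  lspan ((fun B : {set I} => xprod B) @`
           [set` [set B : {set I} | #|B| == d & B \subset T]%SET])
    (\prod_(i < d) iota (v i)).
Proof.
elim: d => [|d IHd] in v *; rewrite ?big_ord0 ?big_ord_recr /= => dT.
  apply: mem_lspan; exists finset.set0; last by rewrite big_set0.
  by rewrite /= inE cards0 finset.sub0set.
have /IHd : (d + r <= #|T|.+1)%N by lia.
move=> /(_ (fun i => v (widen_ord (leqnSn d) i)))/lspan_imageP[c ->].
rewrite mulr_suml; apply: lspan_sum => B; rewrite inE => /andP[/eqP Bd BT].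
rewrite -scalerAl; apply: lspanZ.
have [E ETB Er] : exists2 E : {set I}, E \subset T :\: B & #|E| = r.
  by apply: exists_subset_card; rewrite cardsD (finset.setIidPr BT); lia.
have [_ sE] := gp Er.
have: lspan (x @` [set` E]) (v ord_max) by rewrite sE.
case/lspan_imageP => a ->; rewrite linear_sum mulr_sumr.
apply: lspan_sum => j /(fintype.subsetP ETB); rewrite inE => /andP[jB jT].
rewrite linearZ -scalerAr; apply/lspanZ/mem_lspan; exists (j |: B)%SET.
  by rewrite /= inE cardsU1 jB Bd eqxx finset.subUset finset.sub1set jT.
by rewrite big_setU1 //= mulrC.
Qed.

(** For each B, a linear form that vanishes at x i for i in T \ B but nowhere
    on B induces an algebra morphism to K that isolates the coefficient of B.
    The cardinality condition says that T \ B has r - 1 elements.  It is only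
    imposed in positive degree, so that the case r = d = 0, where no set has
    r - 1 elements, is covered: in degree 0 any form separates the unique B. *)
Lemma squarefree_products_free (T : {set I}) d j0 :
  is_symmetric_algebra iota -> j0 \notin T ->
  ((0 < d)%N -> #|T|.+1 = (d + r)%N) ->
  free_on [set B : {set I} | #|B| == d & B \subset T]%SET
    (fun B : {set I} => xprod B).
Proof.
move=> symA j0T Td c c0 B BD; move: (BD); rewrite inE => /andP[/eqP Bd BT].
have [f [fB fD]] : exists f : {linear V -> K^o},
    (forall i, i \in B -> f (x i) != 0) /\
    (forall E : {set I}, #|E| = d -> E \subset T -> E != B ->
       exists2 i, i \in E & f (x i) = 0).
  case: (posnP d) => [d0|/Td{}Td].
    have B0 : B = finset.set0 by apply/cards0_eq; rewrite Bd.
    exists \0; split=> [i|E]; first by rewrite B0 inE.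
    by rewrite d0 B0 => /cards0_eq-> _ /eqP.
  have j0C : j0 \notin T :\: B by rewrite inE (negPf j0T) andbF.
  have [|f fE] := general_position_form j0C.
    by rewrite cardsD (finset.setIidPr BT); have := subset_leq_card BT; lia.
  exists f; split=> [i iB|E Ed ET EB]; first by rewrite fE inE iB.
  have /subsetPn[i iE iB] : ~~ (E \subset B).
    by apply: contraNN EB => sEB; rewrite eqEcard sEB Bd Ed leqnn.
  exists i => //; apply/eqP; rewrite fE inE iB; exact: (fintype.subsetP ET).
have [[g gE] _] := symA _ f.
have gprod (E : {set I}) : g (xprod E) = \prod_(b in E) (f (x b) : K).
  rewrite rmorph_prod; apply: eq_bigr => b _; exact: gE.
have: g (\sum_(E in [set B : {set I} | #|B| == d & B \subset T]%SET)
           c E *: xprod E) = 0 by rewrite c0 linear0.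
rewrite linear_sum (big_setD1 B BD) /= [X in _ + X]big1 => [|E].
  rewrite addr0 linearZ /= gprod => /eqP; rewrite mulf_eq0 => /orP[/eqP//|].
  by move/prodf_eq0 => [b /fB/negPf->].
rewrite !inE => /and3P[EB /eqP Ed ET]; have [i iE fi] := fD E Ed ET EB.
by rewrite linearZ /= gprod (big_setD1 i) //= fi mul0r scaler0.
Qed.

End GeneralPosition.

(** * T-flats and levels of a uniform matroid *)

Section UniformMatroid.
Context {K : fieldType} {W : lmodType K} {n r : nat} {x : 'I_n -> W}.
Context {X : set W}.
Hypothesis uniform : forall E : {set 'I_n}, #|E| = r -> basis_on E x X.
Hypothesis xX : forall i, X (x i).

Lemma uniform_subspan (J : {set 'I_n}) : (r <= #|J|)%N -> subspan x J = X.
Proof.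
move=> /exists_subset_card[E EJ Er]; have [_ sE] := uniform Er.
apply/seteqP; split=> [|v]; rewrite -sE.
  by apply: lspan_least => _ [i _ <-]; rewrite sE.
apply: lspan_least => _ [i iE <-]; apply: mem_lspan; exists i => //.
exact: (fintype.subsetP EJ).
Qed.

(** Removing any j from C leaves a basis, which makes C dependent because x j
    lies in its span, and makes every proper subset of C independent. *)
Lemma uniform_circuit (C : {set 'I_n}) : #|C| = r.+1 -> circuit x C.
Proof.
move=> Cr; have D1r j : j \in C -> #|C :\ j| = r.
  by move=> jC; apply/eq_add_S; rewrite -Cr (cardsD1 j C) jC.
split=> [|D /fintype.properP[DC [j jC jD]]].
  have /card_gt0P[j jC] : (0 < #|C|)%N by rewrite Cr.
  by apply: (not_free_on jC); have [_ ->] := uniform (D1r j jC).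
apply: free_on_sub (proj1 (uniform (D1r j jC))).
by rewrite subsetD1 DC.
Qed.

(** Every j in J belongs to a circuit inside J: add any r other elements of J. *)
Lemma uniform_tflat (J : {set 'I_n}) : (r < #|J|)%N -> tflat x J.
Proof.
move=> rJ; split=> [J0|]; first by rewrite J0 cards0 in rJ.
exists [set C : {set 'I_n} | (C \subset J) && (#|C| == r.+1)]%SET; split=> [C|].
  by rewrite inE => /andP[_ /eqP]; exact: uniform_circuit.
apply/setP => j; apply/idP/finset.bigcupP => [jJ|[C]]; last first.
  by rewrite inE => /andP[/fintype.subsetP CJ _] /CJ.
have [|E EJ Er] := @exists_subset_card _ (J :\ j) r.
  by have := rJ; rewrite (cardsD1 j) jJ.
have [EJ' jE] := (fintype.subset_trans EJ (subD1set _ _), subsetD1P EJ).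
exists (j |: E)%SET; last exact: setU11.
rewrite inE cardsU1 (negbTE (proj2 jE)) Er eqxx andbT.
by rewrite finset.subUset finset.sub1set jJ.
Qed.

Lemma uniform_level (J : {set 'I_n}) :
  dimension X = r -> (r <= #|J|)%N -> level x J = #|J|%:Z - r%:Z - 1.
Proof. by move=> Xr rJ; rewrite /level uniform_subspan // Xr. Qed.

End UniformMatroid.

(** * The multiplicity space of a uniform matroid *)

Section MultiplicitySpace.
Context {K : fieldType} {n r : nat} {U W : lmodType K}.
Context {e : 'I_n -> U} {phi : {linear U -> W}}.
Context {A : comAlgType K} {iota : {linear im_space phi -> A}}.
Hypothesis repr : represents_uniform e phi r.

(** The bases of the image given by the representation live in W; this moves
    them to the space whose symmetric algebra is considered. *)
Lemma im_of_general_position (E : {set 'I_n}) :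
  #|E| = r -> basis_on E (fun i => im_of phi (e i)) [set: im_space phi].
Proof.
move=> /(proj2 repr)[fE sE]; split=> [c c0|].
  by apply: fE; have /(congr1 val) := c0; rewrite linear_sum.
apply/seteqP; split=> // v _; apply/lspan_imageP.
have /lspan_imageP[c vE] : lspan ((phi \o e) @` [set` E]) (val v).
  by rewrite sE; apply/asboolP; exact: valP v.
by exists c; apply: val_inj; rewrite vE linear_sum.
Qed.

(** The chain starts at the circuit complementary to B and adds the elements of
    B in the order of their enumeration. *)
Lemma phi_prod_generator (B : {set 'I_n}) :
  n = (r + #|B|).+1 -> mult_generator e iota #|B| (phi_prod e iota B).
Proof.
move=> nE; have [dimV uniform] := repr.
have xV i : range phi ((phi \o e) i) by exists (e i).
pose J i := ~: B :|: [set enum_val k | k : 'I_#|B| & (k < i)%N]%SET.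
have cardJ i : (i <= #|B|)%N -> #|J i| = (r + i).+1.
  move=> iB; rewrite cardsU finset.disjoint_setI0 ?cards0 ?subn0; last first.
    rewrite disjoint_sym finset.disjoints_subset finset.setCK.
    by apply/fintype.subsetP => _ /imsetP[k _ ->]; exact: enum_valP.
  rewrite card_imset; last exact: enum_val_inj.
  have -> : #|[set k : 'I_#|B| | (k < i)%N]%SET| = i.
    by rewrite -sum1dep_card big_ord_narrow //= sum1_card card_ord.
  by have := cardsC B; rewrite card_ord; lia.
exists J, (fun k => im_of phi (e (enum_val k))); split.
- move=> i iB; split.
    by apply: (uniform_tflat uniform xV); rewrite (cardJ _ iB); lia.
  rewrite (uniform_level uniform xV dimV); rewrite (cardJ _ iB); lia.
- move=> i iB; apply: finset.setUS; apply: imsetS; apply/fintype.subsetP => k.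
  by rewrite !inE => /ltnW.
- apply/eqP; rewrite eqEcard finset.subsetT cardsT card_ord.
  by rewrite cardJ // -nE leqnn.
- move=> k; split; last first.
    have rJ : (r <= #|J k|)%N by rewrite (cardJ _ (ltnW (ltn_ord k))); lia.
    by rewrite (uniform_subspan uniform xV rJ); exists (e (enum_val k)).
  apply: mem_lspan; exists (enum_val k) => //=; rewrite inE; apply/andP; split.
    rewrite !inE enum_valP /=; apply/imsetP => -[k' k'k /enum_val_inj kk'].
    by move: k'k; rewrite inE kk' ltnn.
  by rewrite !inE; apply/orP; right; apply/imsetP; exists k; rewrite ?inE.
- by rewrite /phi_prod big_enum_val.
Qed.

End MultiplicitySpace.

(* S = {1, ..., n} is 'I_n, counted from 0: the elements 1 and 2 of S are the
   ordinals of value 0 and 1. *)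
Theorem theorem5p3 (K : fieldType) (n r : nat) (U W : lmodType K)
    (e : 'I_n -> U) (phi : {linear U -> W})
    (A : comAlgType K) (iota : {linear im_space phi -> A}) :
  basis_on [set: 'I_n]%SET e [set: U] ->
  represents_uniform e phi r ->
  is_symmetric_algebra iota ->
  mult_space e iota = sym_power iota (n%:Z - r%:Z - 1) /\
  basis_on
    [set B : {set 'I_n} | (#|B|%:Z == n%:Z - r%:Z - 1 :> int)
                          && [forall b in B, (1 < b)%N]]%SET
    (phi_prod e iota)
    (mult_space e iota).
Proof.
move=> be repr symA; have [dimV uniform] := repr.
have xV i : range phi ((phi \o e) i) by exists (e i).
have spanS : subspan (phi \o e) [set: 'I_n]%SET = range phi.
  apply/seteqP; split=> [v /lspan_imageP[c ->]|_ [u _ <-]].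
    exists (\sum_(i in [set: 'I_n]%SET) c i *: e i) => //.
    by rewrite linear_sum; apply: eq_bigr => i _; rewrite linearZ.
  have : [set: U] u by [].
  rewrite -(proj2 be) => /lspan_imageP[c ->]; apply/lspan_imageP; exists c.
  by rewrite linear_sum; apply: eq_bigr => i _; rewrite linearZ.
have levelS : level (phi \o e) [set: 'I_n]%SET = n%:Z - r%:Z - 1.
  by rewrite /level spanS dimV cardsT card_ord.
rewrite /mult_space levelS; case lE: (n%:Z - r%:Z - 1) => [d|d] /=; last first.
  set D := (X in basis_on X); have D0 : D = finset.set0.
    by apply/setP => B; rewrite !inE.
  have -> : [set a : A | if `[< tflat (phi \o e) [set: 'I_n]%SET >]
                         then a = 0 else a = 0] = [set 0].
    by apply/seteqP; split=> a /=; case: ifP.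
  split=> //; rewrite D0; split=> [c _ i|]; first by rewrite inE.
  rewrite -[RHS]lspan_set0; congr lspan; apply/seteqP; split=> // a [B].
  by rewrite /= inE.
have nE : n = (r + d).+1 by lia.
have -> : `[< tflat (phi \o e) [set: 'I_n]%SET >].
  by apply/asboolP/(uniform_tflat uniform xV); rewrite cardsT card_ord nE; lia.
pose T := [set b : 'I_n | (1 < b)%N]%SET.
set D := (X in basis_on X).
have DE : D = [set B : {set 'I_n} | #|B| == d & B \subset T]%SET.
  apply/setP => B; rewrite !inE eqz_nat; congr (_ && _).
  apply/forall_inP/fintype.subsetP => BT b /BT; by rewrite inE.
have cardT : #|T| = n.-2 by exact: card_ord_gt1.
have spanD : sym_power iota d `<=` lspan (phi_prod e iota @` [set` D]).
  apply: lspan_least => _ [v ->]; rewrite DE.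
  apply: (squarefree_products_span (im_of_general_position repr)).
  by rewrite cardT; lia.
have D_mult : phi_prod e iota @` [set` D] `<=` mult_generator e iota d.
  move=> _ [B BD <-]; move: BD; rewrite /= DE inE => /andP[/eqP Bd _].
  by rewrite -Bd; apply: (phi_prod_generator repr); rewrite Bd.
have mult_sym : lspan (mult_generator e iota d) `<=` sym_power iota d.
  by apply: lspan_least => _ [J [w [_ _ _ _ ->]]]; apply: mem_lspan; exists w.
(* The multiplicity space is squeezed between the span of the products and
   the symmetric power, which is itself spanned by these products. *)
have spanDE :
    lspan (phi_prod e iota @` [set` D]) = lspan (mult_generator e iota d).
  apply/seteqP; split; first by apply: lspan_least => a /D_mult/mem_lspan.
  exact: subset_trans mult_sym spanD.
have -> : [set a : A | lspan (mult_generator e iota d) a] =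
          lspan (mult_generator e iota d) by [].
split; first by apply/seteqP; split=> //; rewrite -spanDE.
split=> //; rewrite DE.
have n_gt0 : (0 < n)%N by rewrite nE.
have j0T : Ordinal n_gt0 \notin T by rewrite inE.
apply: (squarefree_products_free (im_of_general_position repr) symA j0T).
by rewrite cardT; lia.
Qed.
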